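(* Let $E\subset\mathbb{R}^d$ be a homogeneous Moran set with $c_*=\inf_k c_k>0$. Then, for every $\theta\in(0,1]$, $$\overline{\dim}_\theta E=\limsup_{k\to\infty}\ \min_{k\le m\le l(k,\theta)}\ -\frac{\log (n_1\cdots n_m)}{\log (c_1\cdots c_m)},$$ and, for every $\theta\in[0,1]$, $$\underline{\dim}_\theta E=\liminf_{k\to\infty}\ -\frac{\log (n_1\cdots n_k)}{\log (c_1\cdots c_k)}=\dim_H E .$$
   Context: Intermediate dimensions. $|\cdot|$ denotes the diameter of a set and $\dim_H$ the Hausdorff dimension. For $E\subset\mathbb{R}^d$ and $0\le\theta\le1$ (with $\delta^{1/\theta}$ read as $0$ when $\theta=0$, so that both dimensions equal $\dim_H E$): $\underline{\dim}_\theta E=\inf\{s\ge0:$ for all $\varepsilon>0$ and $\Delta>0$ there exist $0<\delta\le\Delta$ and a cover $\{U_i\}$ of $E$ such that $\delta^{1/\theta}\le|U_i|\le\delta$ for all $i$ and $\sum|U_i|^s\le\varepsilon\}$; $\overline{\dim}_\theta E=\inf\{s\ge0:$ for all $\varepsilon>0$ there exists $\Delta>0$ such that for all $0<\delta\le\Delta$ there is a cover $\{U_i\}$ of $E$ such that $\delta^{1/\theta}\le|U_i|\le\delta$ for all $i$ and $\sum|U_i|^s\le\varepsilon\}$. Homogeneous Moran sets. Let $\{n_k\}_{k\ge1}$ be integers $\ge2$. $\Sigma^k=\{u_1\cdots u_k:1\le u_j\le n_j\}$, $\Sigma^0=\{\emptyset\}$, $\Sigma^*=\bigcup_{k\ge0}\Sigma^k$.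 Let $J\subset\mathbb{R}^d$ be compact with nonempty interior, and let $c_k>0$ satisfy $n_kc_k^d\le1$ for all $k\ge1$. Let $\{J_{\mathbf{u}}:\mathbf{u}\in\Sigma^*\}$ be closed subsets of $J$ such that: (1) for each $\mathbf{u}$ there is a similarity $\Psi_{\mathbf{u}}:\mathbb{R}^d\to\mathbb{R}^d$ with $J_{\mathbf{u}}=\Psi_{\mathbf{u}}(J)$, and $J_\emptyset=J$; (2) for all $k\ge1$ and $\mathbf{u}\in\Sigma^{k-1}$, the sets $J_{\mathbf{u}1},\dots,J_{\mathbf{u}n_k}$ are subsets of $J_{\mathbf{u}}$ with pairwise disjoint interiors and $|J_{\mathbf{u}i}|/|J_{\mathbf{u}}|=c_k$ for $1\le i\le n_k$. Then $E=\bigcap_{k\ge1}\bigcup_{\mathbf{u}\in\Sigma^k}J_{\mathbf{u}}$ is called a homogeneous Moran set. For $k\ge1$ and $\theta\in(0,1]$, $l(k,\theta)=l$ is the unique integer such that $c_1c_2\cdots c_l\le(c_1c_2\cdots c_k)^{1/\theta}<c_1c_2\cdots c_{l-1}$ (the empty product being $1$). *)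

(* Defs.v *)
From HB Require Import structures.
From mathcomp Require Import all_boot all_order all_algebra.
From mathcomp Require Import all_classical all_reals all_analysis.

Set Implicit Arguments.
Unset Strict Implicit.
Unset Printing Implicit Defensive.

Import Order.TTheory GRing.Theory Num.Theory.
Import numFieldNormedType.Exports.

Local Open Scope classical_set_scope.
Local Open Scope ring_scope.

(* The library norm on 'rV[R]_d is the sup norm, so the Euclidean distance is
   defined by hand; both induce the library topology on 'rV[R]_d. *)
Definition edist (R : realType) (d : nat) (x y : 'rV[R]_d) : R :=
  Num.sqrt (\sum_(i < d) (x 0 i - y 0 i) ^+ 2).

(* Extended-real valued, so that unbounded sets have diameter +oo; the maximum
   with 0 gives the empty set diameter 0. *)
Definition diam (R : realType) (d : nat) (A : set 'rV[R]_d) : \bar R :=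
  maxe 0%E (ereal_sup [set (edist x y)%:E | x in A & y in A]).

(* A finite or countable cover {U_i : i in D}. In the sums of |U_i|^s below,
   0^0 = 1 (the convention of the library power). *)
Definition is_cover (R : realType) (d : nat) (E : set 'rV[R]_d)
    (D : set nat) (U : nat -> set 'rV[R]_d) : Prop :=
  E `<=` \bigcup_(i in D) U i.

Definition cover_sum (R : realType) (d : nat) (s : R)
    (D : set nat) (U : nat -> set 'rV[R]_d) : \bar R :=
  (\esum_(i in D) (diam (U i) `^ s))%E.

Definition hausdorff_premeasure (R : realType) (d : nat) (s delta : R)
    (E : set 'rV[R]_d) : \bar R :=
  ereal_inf [set x | exists (D : set nat) (U : nat -> set 'rV[R]_d),
    [/\ is_cover E D U,
        forall i, D i -> (diam (U i) <= delta%:E)%E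
      & x = cover_sum s D U]].

Definition hausdorff_measure (R : realType) (d : nat) (s : R)
    (E : set 'rV[R]_d) : \bar R :=
  ereal_sup [set hausdorff_premeasure s delta E | delta in [set x : R | 0 < x]].

Definition hausdorff_dim (R : realType) (d : nat) (E : set 'rV[R]_d) : \bar R :=
  ereal_inf [set s%:E | s in [set s : R | 0 <= s /\
    hausdorff_measure s E = 0%E]].

(* delta^(1/theta), read as 0 when theta = 0. *)
Definition scale_pow (R : realType) (delta theta : R) : R :=
  if theta == 0 then 0 else delta `^ theta^-1.

Definition theta_cover (R : realType) (d : nat) (theta delta : R)
    (E : set 'rV[R]_d) (D : set nat) (U : nat -> set 'rV[R]_d) : Prop :=
  is_cover E D U /\
  forall i, D i ->
    ((scale_pow delta theta)%:E <= diam (U i))%E /\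
    (diam (U i) <= delta%:E)%E.

Definition lower_intermediate_dim (R : realType) (d : nat) (theta : R)
    (E : set 'rV[R]_d) : \bar R :=
  ereal_inf [set s%:E | s in [set s : R | 0 <= s /\
    forall eps Delta : R, 0 < eps -> 0 < Delta ->
    exists delta : R, 0 < delta <= Delta /\
    exists (D : set nat) (U : nat -> set 'rV[R]_d),
      theta_cover theta delta E D U /\ (cover_sum s D U <= eps%:E)%E]].

Definition upper_intermediate_dim (R : realType) (d : nat) (theta : R)
    (E : set 'rV[R]_d) : \bar R :=
  ereal_inf [set s%:E | s in [set s : R | 0 <= s /\
    forall eps : R, 0 < eps ->
    exists Delta : R, 0 < Delta /\
    forall delta : R, 0 < delta <= Delta ->
    exists (D : set nat) (U : nat -> set 'rV[R]_d),
      theta_cover theta delta E D U /\ (cover_sum s D U <= eps%:E)%E]].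

Definition similarity (R : realType) (d : nat) (f : 'rV[R]_d -> 'rV[R]_d) :
    Prop :=
  exists r : R, 0 < r /\ forall x y, edist (f x) (f y) = r * edist x y.

(* Sequences n and c are indexed from 1: their value at 0 is never used.
   The letter u_j of a word u = u_1 ... u_k is nth 0 u j.-1. *)
Definition words (n : nat -> nat) (k : nat) : set (seq nat) :=
  [set u | size u = k /\
    forall j, (1 <= j <= k)%N -> (1 <= nth 0%N u j.-1 <= n j)%N].

(* J is the compact set and Jw u the set indexed by the word u; the values of
   Jw at sequences that are not words are irrelevant. *)
Definition moran_structure (R : realType) (d : nat) (n : nat -> nat)
    (c : nat -> R) (J : set 'rV[R]_d) (Jw : seq nat -> set 'rV[R]_d) : Prop :=
  [/\ forall k, (1 <= k)%N ->
        [/\ (2 <= n k)%N, 0 < c k & (n k)%:R * c k ^+ d <= 1],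
      compact J /\ interior J !=set0,
      forall k u, words n k u -> closed (Jw u) /\ Jw u `<=` J,
      Jw [::] = J /\
      (forall k u, words n k u ->
        exists Psi : 'rV[R]_d -> 'rV[R]_d,
          similarity Psi /\ Jw u = Psi @` J)
    & forall k u, (1 <= k)%N -> words n k.-1 u ->
        (forall i, (1 <= i <= n k)%N ->
          Jw (rcons u i) `<=` Jw u /\
          (diam (Jw (rcons u i)) / diam (Jw u))%E = (c k)%:E) /\
        (forall i j, (1 <= i <= n k)%N -> (1 <= j <= n k)%N -> i <> j ->
          interior (Jw (rcons u i)) `&` interior (Jw (rcons u j)) = set0)].

Definition homogeneous_moran_set (R : realType) (d : nat) (n : nat -> nat)
    (c : nat -> R) (E : set 'rV[R]_d) : Prop :=
  exists (J : set 'rV[R]_d) (Jw : seq nat -> set 'rV[R]_d),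
    moran_structure n c J Jw /\
    E = \bigcap_(k in [set k | (1 <= k)%N]) \bigcup_(u in words n k) Jw u.

Definition cprod (R : realType) (c : nat -> R) (k : nat) : R :=
  \prod_(1 <= j < k.+1) c j.

Definition nprod (n : nat -> nat) (k : nat) : nat :=
  (\prod_(1 <= j < k.+1) n j)%N.

(* The unique l with c_1...c_l <= (c_1...c_k)^(1/theta) < c_1...c_(l-1); it
   exists for k >= 1 and 0 < theta <= 1 as soon as the c_j lie in ]0, 1[ and
   their products tend to 0, as for any homogeneous Moran set with d >= 1. The
   value l = 0, where l.-1 is not l - 1, never satisfies the condition. *)
Definition lindex (R : realType) (c : nat -> R) (k : nat) (theta : R) : nat :=
  xget 0%N [set l | cprod c l <= cprod c k `^ theta^-1 < cprod c l.-1].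

Definition log_ratio (R : realType) (n : nat -> nat) (c : nat -> R) (m : nat) :
    R :=
  - (ln (nprod n m)%:R / ln (cprod c m)).

(* Main.v *)
Require Import Defs.
From mathcomp Require Import all_boot all_order all_algebra.
From mathcomp Require Import all_classical all_reals all_analysis.
From mathcomp Require Import finmap ring lra.

Set Implicit Arguments.
Unset Strict Implicit.
Unset Printing Implicit Defensive.

Import Order.TTheory GRing.Theory Num.Theory.
Import numFieldNormedType.Exports.
Import Defs.

Local Open Scope classical_set_scope.
Local Open Scope ring_scope.

(** Write N m = n_1...n_m and C m = c_1...c_m.  At level m the set E is covered by
N m pieces of the same diameter, C m * |J|, and the uniform mass distribution
gives each of them the mass 1 / N m.  The number log (N m) / - log (C m) exceeds
s exactly when N m * C m ^ s > 1, that is, when the pieces of level m have mass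
smaller than the s-th power of C m.  Everything follows by choosing levels.

Upper bounds.  If log_ratio m < t < s, the pieces of level m, enlarged to cubes
of one common diameter b of order C m, form a cover whose s-sum is at most a
constant times C m ^ (s - t), which is small when m is large (small_cover).  If
such m occur infinitely often, then s bounds the lower intermediate dimension
for every theta, with delta = b (lower_covers).  For the upper intermediate
dimension, delta is given; it is comparable to C k for some k, and the diameters
allowed are, up to constants, those of the pieces of levels k to l(k, theta).  A
level m in this range with log_ratio m < t therefore provides a cover; since b
is a free parameter of the cubes, the constants never push the diameter out of
the interval from delta ^ (1 / theta) to delta (upper_covers).

Lower bounds.  The infimum of the c_k is positive, so that every r in ]0, 1[
lies between C m and a constant times C m for some m (level_exists).  A set
of diameter r then meets boundedly many pieces of level m (piece_count): these
contain disjoint balls of radius of order C m, because similarities are onto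
(similarity_surj) and the pieces have disjoint interiors.  Hence a set U_i of
diameter r_i has mass at most M / N (m_i), and for every countable cover
1 <= M * sum_i 1 / N (m_i) (mass_bound).  If all the levels m_i satisfy
log_ratio (m_i) > s, each term is at most r_i ^ s and the s-sum of the cover is
at least 1 / M.  For diameters between C k ^ (1 / theta) and C k the levels m_i
lie between k and l(k, theta), which gives the lower bound for the upper
intermediate dimension (no_upper_cover); for arbitrary small diameters the m_i
are merely large, which gives the one for the Hausdorff dimension
(hausdorff_measure_neq0).  As dim_H is at most the lower intermediate dimension,
the chain liminf <= dim_H <= lower dimension <= liminf closes.

The sup norm, which defines the topology, is used throughout; the Euclidean
distance is comparable to it. *)

(** * Euclidean distance, diameters and similarities *)

Lemma coord_le_norm (R : realType) (d : nat) (x : 'rV[R]_d) (i : 'I_d) :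
  `|x 0 i| <= `|x|.
Proof.
by rewrite [leRHS]/Num.norm/= mx_normrE; apply/bigmax_geP; right; exists (0, i).
Qed.

Lemma norm_le_coord (R : realType) (d : nat) (x : 'rV[R]_d) (a : R) :
  0 <= a -> (forall i, `|x 0 i| <= a) -> `|x| <= a.
Proof.
move=> a0 xa; rewrite [leLHS]/Num.norm/= mx_normrE; apply/bigmax_leP; split=> //.
by move=> [i j] _ /=; rewrite (ord1 i).
Qed.

Lemma norm_lt_coord (R : realType) (d : nat) (x : 'rV[R]_d) (a : R) :
  0 < a -> (forall i, `|x 0 i| < a) -> `|x| < a.
Proof.
move=> a0 xa; rewrite [ltLHS]/Num.norm/= mx_normrE; apply/bigmax_ltP; split=> //.
by move=> [i j] _ /=; rewrite (ord1 i).
Qed.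

Lemma edist_ge0 (R : realType) (d : nat) (x y : 'rV[R]_d) : 0 <= edist x y.
Proof. exact: sqrtr_ge0. Qed.

Lemma sqr_edist (R : realType) (d : nat) (x y : 'rV[R]_d) :
  edist x y ^+ 2 = \sum_(i < d) (x 0 i - y 0 i) ^+ 2.
Proof. by rewrite sqr_sqrtr// sumr_ge0// => i _; exact: sqr_ge0. Qed.

Lemma edistC (R : realType) (d : nat) (x y : 'rV[R]_d) : edist x y = edist y x.
Proof. by congr Num.sqrt; apply: eq_bigr => i _; rewrite -sqrrN opprB. Qed.

Lemma norm_le_edist (R : realType) (d : nat) (x y : 'rV[R]_d) :
  `|x - y| <= edist x y.
Proof.
apply: norm_le_coord => [|i]; first exact: edist_ge0.
rewrite -sqrtr_sqr ler_sqrt; last by apply: sumr_ge0 => j _; exact: sqr_ge0.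
rewrite (bigD1 i)//= !mxE lerDl; apply: sumr_ge0 => j _; exact: sqr_ge0.
Qed.

Lemma edist_le_norm (R : realType) (d : nat) (x y : 'rV[R]_d) :
  edist x y <= Num.sqrt d%:R * `|x - y|.
Proof.
rewrite -(ger0_norm (normr_ge0 (x - y))) -sqrtr_sqr -sqrtrM ?ler0n// ler_sqrt.
  have -> : d%:R * `|x - y| ^+ 2 = \sum_(i < d) `|x - y| ^+ 2.
    by rewrite sumr_const card_ord mulr_natl.
  apply: ler_sum => i _.
  rewrite -real_normK ?num_real// lerXn2r ?nnegrE//.
  by have := coord_le_norm (x - y) i; rewrite !mxE.
by rewrite mulr_ge0// ?ler0n ?sqr_ge0.
Qed.

Section diameter.
Variables (R : realType) (d : nat).
Implicit Types (A B : set 'rV[R]_d) (x y : 'rV[R]_d) (a : R).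

Lemma diam_ge0 A : (0 <= diam A)%E.
Proof. by rewrite /diam le_max lexx. Qed.

Lemma edist_le_diam A x y : A x -> A y -> ((edist x y)%:E <= diam A)%E.
Proof.
move=> Ax Ay; rewrite /diam le_max; apply/orP; right.
by apply: ereal_sup_ubound; exists x => //; exists y.
Qed.

Lemma diam_leP A a : 0 <= a ->
  reflect (forall x y, A x -> A y -> edist x y <= a) (diam A <= a%:E)%E.
Proof.
move=> a0; apply: (iffP idP) => [Aa x y Ax Ay|Aa].
  by rewrite -lee_fin (le_trans (edist_le_diam Ax Ay)).
rewrite /diam ge_max lee_fin a0/=; apply: ge_ereal_sup => _ [x Ax [y Ay <-]].
by rewrite lee_fin Aa.
Qed.

Lemma diam_bounded A : bounded_set A -> (diam A < +oo)%E.
Proof.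
move=> [M [_ AM]].
have M1 : M < `|M| + 1 by rewrite (le_lt_trans (ler_norm M)) ?ltrDl.
have a0 : 0 <= Num.sqrt d%:R * ((`|M| + 1) + (`|M| + 1)) by rewrite mulr_ge0.
apply: le_lt_trans (ltry _); apply/diam_leP; first exact: a0.
move=> x y Ax Ay; apply: le_trans (edist_le_norm x y) _.
rewrite ler_wpM2l// (le_trans (ler_normB _ _))// lerD//; exact: AM M1 _ _.
Qed.

(** Cubes serve as sets of prescribed Euclidean diameter: it is attained at two
opposite corners. *)
Lemma diam_cube (z : 'rV[R]_d) (h : R) : (0 < d)%N -> 0 <= h ->
  diam [set x | `|x - z| <= h] = (Num.sqrt d%:R * (2 * h))%:E.
Proof.
move=> d0 h0; have dh0 : 0 <= Num.sqrt d%:R * (2 * h).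
  by rewrite !mulr_ge0.
apply/eqP; rewrite eq_le; apply/andP; split.
  apply/diam_leP => // x y /= xz yz; apply: le_trans (edist_le_norm x y) _.
  rewrite ler_wpM2l//; rewrite -[x](subrK z) -addrA -(opprB y z).
  by rewrite (le_trans (ler_normB _ _))// mulr2n mulrDl mul1r lerD.
pose x := z + const_mx h; pose y := z - const_mx h.
have xE : `|x - z| <= h.
  by apply: norm_le_coord => // i; rewrite !mxE addrAC subrr add0r ger0_norm.
have yE : `|y - z| <= h.
  apply: norm_le_coord => // i.
  by rewrite !mxE addrAC subrr add0r normrN ger0_norm.
suff -> : (Num.sqrt d%:R * (2 * h)) = edist x y by exact: edist_le_diam.
rewrite -[2 * h]ger0_norm ?mulr_ge0// -sqrtr_sqr -sqrtrM ?ler0n//.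
congr Num.sqrt; have -> : d%:R * (2 * h) ^+ 2 = \sum_(i < d) (2 * h) ^+ 2.
  by rewrite sumr_const card_ord mulr_natl.
apply: eq_bigr => i _; rewrite !mxE; congr (_ ^+ 2).
by rewrite opprD opprK addrACA subrr add0r mulr2n mulrDl mul1r.
Qed.

End diameter.

(** Similarities are onto.  Normalised to fix 0 and to have ratio 1, a
similarity [g] preserves inner products by polarisation; the matrix [A] whose
rows are the images of the basis vectors is then orthogonal, and
[g x = x *m A]. *)
Lemma similarity_surj (R : realType) (d : nat) (f : 'rV[R]_d -> 'rV[R]_d)
    (r : R) :
  0 < r -> (forall x y, edist (f x) (f y) = r * edist x y) ->
  forall y, exists x, f x = y.
Proof.
move=> r0 fr.
pose g x := r^-1 *: (f x - f 0).
pose dot (x y : 'rV[R]_d) := \sum_(i < d) x 0 i * y 0 i.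
pose sq (x y : 'rV[R]_d) := \sum_(i < d) (x 0 i - y 0 i) ^+ 2.
have sqE x y : sq x y = dot x x - 2 * dot x y + dot y y.
  rewrite /sq /dot mulr_sumr -sumrB -big_split/=; apply: eq_bigr => i _.
  by rewrite sqrrB !expr2 mulr_natl.
have gsq x y : sq (g x) (g y) = sq x y.
  have : r ^- 2 * edist (f x) (f y) ^+ 2 = edist x y ^+ 2.
    by rewrite fr exprMn mulKf// expf_neq0// gt_eqF.
  rewrite !sqr_edist -/(sq x y) => <-.
  rewrite mulr_sumr; apply: eq_bigr => i _; rewrite !mxE -mulrBr exprMn exprVn.
  by congr (_ * _ ^+ 2); rewrite opprB addrA subrK.
have g0 : g 0 = 0 by rewrite /g subrr scaler0.
have dot0 x : dot x 0 = 0 by rewrite /dot big1// => i _; rewrite mxE mulr0.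
have dotg x : dot (g x) (g x) = dot x x.
  by have := gsq x 0; rewrite g0 !sqE !dot0 mulr0 !subr0 !addr0.
have gdot x y : dot (g x) (g y) = dot x y.
  have := gsq x y; rewrite !sqE !dotg => /addIr /addrI /oppr_inj.
  by apply: mulfI; rewrite pnatr_eq0.
pose e (i : 'I_d) : 'rV[R]_d := delta_mx 0 i.
have dote x i : dot x (e i) = x 0 i.
  rewrite /dot (bigD1 i)//= mxE !eqxx mulr1 big1 ?addr0// => j ji.
  by rewrite mxE (negbTE ji) andbF mulr0.
pose A : 'M[R]_d := \matrix_(i, j) g (e i) 0 j.
have gA x : g x *m A^T = x.
  apply/rowP => i; rewrite mxE -[RHS]dote -gdot /dot.
  by apply: eq_bigr => j _; rewrite !mxE.
have AA : A *m A^T = 1%:M.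
  apply/row_matrixP => i; rewrite row_mul row1 -[RHS]gA; congr (_ *m _).
  by apply/rowP => j; rewrite !mxE.
have AA' := mulmx1C AA.
move=> y; exists (r^-1 *: (y - f 0) *m A^T).
set x := _ *m A^T.
have gx : g x = r^-1 *: (y - f 0).
  by rewrite -[g x]mulmx1 -AA' mulmxA gA /x -mulmxA AA' mulmx1.
have rV0 : r^-1 != 0 by rewrite invr_eq0 gt_eqF.
exact: addIr (scalerI rV0 gx).
Qed.

(** * Words *)

Lemma nprodS n k : nprod n k.+1 = (nprod n k * n k.+1)%N.
Proof. by rewrite /nprod big_nat_recr. Qed.

Lemma nprod0 n : nprod n 0 = 1%N.
Proof. by rewrite /nprod big_geq. Qed.

Fixpoint word_seq (n : nat -> nat) (k : nat) : seq (seq nat) :=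
  if k is k'.+1 then [seq rcons u i | u <- word_seq n k', i <- iota 1 (n k)]
  else [:: [::]].

Lemma words_rcons n k u i :
  words n k.+1 (rcons u i) <-> words n k u /\ (1 <= i <= n k.+1)%N.
Proof.
rewrite /words/= size_rcons; split=> [[[su] H]|[[su H] Hi]].
  split; last by have := H k.+1; rewrite /= nth_rcons su ltnn eqxx leqnn; exact.
  split=> // j /andP[j1 jk]; have := H j; rewrite j1 (leqW jk) => /(_ isT).
  by rewrite nth_rcons su prednK// jk.
split=> [|j /andP[j1]]; first by rewrite su.
rewrite leq_eqVlt => /predU1P[->|jk]; first by rewrite /= nth_rcons su ltnn eqxx.
have {}jk : (j <= k)%N by [].
by rewrite nth_rcons su prednK// jk H// j1.
Qed.

Lemma words0 n u : words n 0 u <-> u = [::].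
Proof.
split=> [[/size0nil]//|->]; split=> // j /andP[j1 j0].
by have := leq_trans j1 j0.
Qed.

Lemma word_seqP n k u : reflect (words n k u) (u \in word_seq n k).
Proof.
elim: k u => [|k IH] u.
  by rewrite inE; apply: (iffP eqP) => /words0.
apply: (iffP allpairsP) => [[[v i] /= [/IH vk]]|].
  by rewrite mem_iota add1n ltnS => ik ->; apply/words_rcons.
case/lastP: u => [[]//|v i] /words_rcons[/IH vk ik].
by exists (v, i); split=> //=; rewrite mem_iota add1n ltnS.
Qed.

Lemma word_seq_uniq n k : uniq (word_seq n k).
Proof.
elim: k => //= k IH; apply: allpairs_uniq => //; first exact: iota_uniq.
by move=> [u i] [v j] _ _ /= /rcons_inj[-> ->].
Qed.

Lemma size_word_seq n k : size (word_seq n k) = nprod n k.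
Proof.
elim: k => [|k IH]; first by rewrite nprod0.
by rewrite /= size_allpairs IH size_iota nprodS.
Qed.

Lemma take_word n k m u : (m <= k)%N -> words n k u -> words n m (take m u).
Proof.
elim: k u => [|k IH] u; first by rewrite leqn0 => /eqP-> _; rewrite take0; apply/words0.
rewrite leq_eqVlt => /predU1P[-> ku|mk].
  by rewrite take_oversize//; case: ku => ->.
case/lastP: u => [[]//|u i] /words_rcons[ku _].
by rewrite -cats1 takel_cat; [exact: IH|case: ku => ->].
Qed.

Lemma count_take_rcons m (u : seq nat) (s : seq (seq nat)) (t : seq nat) :
  all (fun v => m <= size v)%N s ->
  count (fun w => take m w == u) [seq rcons v i | v <- s, i <- t] =
  (count (fun w => take m w == u) s * size t)%N.
Proof.
elim: s => //= v s IH /andP[mv /IH {}IH].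
rewrite count_cat IH mulnDl count_map; congr (_ + _)%N.
rewrite (eq_count (a2 := fun=> take m v == u)) => [|i /=].
  by case: eqP; rewrite ?mul1n ?mul0n ?count_predT ?count_pred0.
by rewrite -cats1 takel_cat.
Qed.

(** Each word of level [m] has [N k / N m] extensions of level [k]: this is the mass
[1 / N m] of a piece, in units of [1 / N k]. *)
Lemma count_extensions n k m u : (m <= k)%N ->
  (count (fun w => take m w == u) (word_seq n k) * nprod n m <= nprod n k)%N.
Proof.
move=> /subnK <-; elim: (k - m)%N => [|j IH]; rewrite ?add0n ?addSn.
  rewrite (eq_in_count (a2 := pred1 u)) => [|w /word_seqP[sw _]]; last first.
    by rewrite take_oversize// sw.
  rewrite count_uniq_mem ?word_seq_uniq//.
  by case: (_ \in _); rewrite ?mul1n ?mul0n.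
rewrite [word_seq _ _.+1]/= count_take_rcons; last first.
  by apply/allP => v /word_seqP[-> _]; rewrite leq_addl.
by rewrite size_iota nprodS mulnAC leq_mul2r IH orbT.
Qed.

Lemma count_has_sum (I T : Type) (P : I -> pred T) (r : seq I) (s : seq T) :
  (count (fun w => has (P^~ w) r) s <= \sum_(i <- r) count (P i) s)%N.
Proof.
elim: r => [|i r IH]; first by rewrite big_nil count_pred0.
rewrite big_cons; apply: leq_trans (leq_add (leqnn _) IH).
by rewrite -count_predUI leq_addr.
Qed.

(** * Packing *)

(** Points of a ball of radius [a * h] that are [b * h]-separated are counted by
the cells of a grid of mesh [b * h]: two of them never share a cell.  The bound
depends on [a / b] and on the dimension only, not on the scale [h]. *)
Lemma packing_bound (R : realType) (d : nat) (a b : R) : 0 < b ->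
  exists M : nat, forall (T : eqType) (s : seq T) (p : T -> 'rV[R]_d)
    (z : 'rV[R]_d) (h : R), 0 < h -> uniq s ->
    {in s, forall u, `|p u - z| <= a * h} ->
    {in s &, forall u v, u != v -> b * h <= `|p u - p v|} ->
  (size s <= M)%N.
Proof.
move=> b0; pose K := Num.truncn (2 * a / b).
exists #|{ffun 'I_d -> 'I_K.+1}| => T s p z h h0 us pz sep.
have bh0 : 0 < b * h by rewrite mulr_gt0.
pose x u i := ((p u - z) 0 i + a * h) / (b * h).
have x0K u i : u \in s -> 0 <= x u i <= 2 * a / b.
  move=> /pz /(le_trans (coord_le_norm _ i)); rewrite ler_norml => /andP[l r].
  have -> : 0 <= x u i.
    by apply: divr_ge0; [rewrite -lerBlDr sub0r|exact: ltW].
  rewrite /x/= ler_pdivrMr// [leRHS](_ : _ = a * h + a * h) ?lerD2r//.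
  rewrite mulrA divfK ?gt_eqF// mulr2n mulrDl mul1r mulrDl//.
pose code u := [ffun i => inord (Num.truncn (x u i)) : 'I_K.+1].
have codeE u i : u \in s -> code u i = Num.truncn (x u i) :> nat.
  move=> us'; rewrite ffunE inordK// ltnS; apply: le_truncn.
  by case/andP: (x0K u i us').
have inj : {in s &, injective code}.
  move=> u v us' vs' uv; apply/eqP; apply: contraT => /(sep _ _ us' vs').
  rewrite leNgt => /negP[]; apply: norm_lt_coord => // i.
  have {uv}: Num.truncn (x u i) = Num.truncn (x v i).
    by rewrite -!codeE// uv.
  have /andP[xu _] := x0K u i us'; have /andP[xv _] := x0K v i vs'.
  have /andP[] := truncn_itv xu; have /andP[] := truncn_itv xv.
  rewrite -!natr1 => h1 h2 h3 h4 e; rewrite e in h3 h4.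
  have : `|x u i - x v i| < 1.
    by rewrite ltr_norml; apply/andP; split; lra.
  rewrite /x -mulrBl normrM normfV (gtr0_norm bh0) ltr_pdivrMr// mul1r.
  by rewrite opprD addrACA subrr addr0 !mxE opprB addrA subrK.
rewrite -(size_map code) -(card_uniqP _) ?max_card// map_inj_in_uniq//.
Qed.

(** * The geometry of a homogeneous Moran set *)

Section moran.
Variables (R : realType) (d : nat) (n : nat -> nat) (c : nat -> R).
Variables (J : set 'rV[R]_d) (Jw : seq nat -> set 'rV[R]_d).
Hypotheses (d0 : (0 < d)%N) (JwP : moran_structure n c J Jw).

Local Notation C := (cprod c).
Local Notation N := (nprod n).

Lemma n_ge2 k : (0 < k)%N -> (2 <= n k)%N.
Proof. by case: JwP => H _ _ _ _ /H[]. Qed.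

Lemma c_gt0 k : (0 < k)%N -> 0 < c k.
Proof. by case: JwP => H _ _ _ _ /H[]. Qed.

Lemma ncd_le1 k : (0 < k)%N -> (n k)%:R * c k ^+ d <= 1.
Proof. by case: JwP => H _ _ _ _ /H[]. Qed.

Lemma c_lt1 k : (0 < k)%N -> c k < 1.
Proof.
move=> k0; rewrite ltNge; apply/negP => c1; have := ncd_le1 k0.
rewrite leNgt => /negP; apply; rewrite (@lt_le_trans _ _ (n k)%:R)//.
  by rewrite ltr1n n_ge2.
by rewrite ler_peMr// exprn_ege1.
Qed.

Lemma cprod0 : C 0 = 1. Proof. by rewrite /cprod big_geq. Qed.

Lemma cprodS k : C k.+1 = C k * c k.+1.
Proof. by rewrite /cprod big_nat_recr. Qed.

Lemma cprod_gt0 k : 0 < C k.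
Proof.
elim: k => [|k IH]; first by rewrite cprod0.
by rewrite cprodS mulr_gt0// c_gt0.
Qed.

Lemma cprod_ltS k : C k.+1 < C k.
Proof. by rewrite cprodS gtr_pMr ?cprod_gt0 ?c_lt1. Qed.

Lemma cprod_le m k : (m <= k)%N -> C k <= C m.
Proof.
move=> /subnK <-; elim: (k - m)%N => [|j IH]; rewrite ?add0n// addSn.
by rewrite (le_trans _ IH)// ltW// cprod_ltS.
Qed.

Lemma cprod_lt1 k : (0 < k)%N -> C k < 1.
Proof.
by move=> /cprod_le /le_lt_trans; apply; rewrite -cprod0 cprod_ltS.
Qed.

Lemma nprod_ge k : (2 ^ k <= N k)%N.
Proof.
elim: k => [|k IH]; first by rewrite nprod0.
by rewrite nprodS expnSr leq_mul// n_ge2.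
Qed.

Lemma nprod_gt0 k : (0 < N k)%N.
Proof. by rewrite (leq_trans _ (nprod_ge k))// expn_gt0. Qed.

(** Multiplying the volume conditions [n k * c k ^+ d <= 1]; together with
[2 ^ k <= N k] this forces [C k] to tend to 0. *)
Lemma nprod_cprod_le1 k : (N k)%:R * C k ^+ d <= 1.
Proof.
elim: k => [|k IH]; first by rewrite nprod0 cprod0 expr1n mulr1.
rewrite nprodS cprodS natrM exprMn mulrACA mulr_ile1 ?ncd_le1//.
  by rewrite mulr_ge0// exprn_ge0// ltW// cprod_gt0.
by rewrite mulr_ge0// exprn_ge0// ltW// c_gt0.
Qed.

Lemma cprod_small (eta : R) : 0 < eta ->
  exists K, forall k, (K <= k)%N -> C k < eta.
Proof.
move=> eta0; exists (Num.bound (eta ^- d)) => k /upper_nthrootP Hk.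
rewrite -(@ltr_pXn2r _ d)// ?nnegrE ?(ltW eta0) ?(ltW (cprod_gt0 k))//.
have Nk : (eta ^+ d)^-1 < (N k)%:R.
  by rewrite (lt_le_trans Hk)// -natrX ler_nat nprod_ge.
have N0 : 0 < (N k)%:R :> R by rewrite ltr0n nprod_gt0.
rewrite -(@ltr_pM2l _ (N k)%:R)// (le_lt_trans (nprod_cprod_le1 k))//.
by rewrite -ltr_pdivrMr ?exprn_gt0// mul1r.
Qed.

Lemma words_cat_nseq1 k j w : words n k w -> words n (j + k) (w ++ nseq j 1%N).
Proof.
move=> kw; elim: j => [|j IH]; first by rewrite cats0.
rewrite -addn1 nseqD catA cats1 addn1 addSn; apply/words_rcons; split=> //.
by rewrite (leq_trans _ (n_ge2 _)).
Qed.

Lemma piece_rcons_sub k u i : words n k.+1 (rcons u i) ->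
  Jw (rcons u i) `<=` Jw u.
Proof.
by case: JwP => _ _ _ _ H /words_rcons[ku ik]; have [+ _] := H k.+1 u isT ku;
  move=> /(_ i ik)[].
Qed.

Lemma piece_sub_take k m u : words n k u -> (m <= k)%N -> Jw u `<=` Jw (take m u).
Proof.
elim: k u => [|k IH] u ku.
  by move=> _; move/words0: ku => ->; case: m => [|m]; exact: subset_refl.
rewrite leq_eqVlt => /predU1P[->|mk].
  rewrite take_oversize; first exact: subset_refl.
  by case: ku => ->.
case/lastP: u ku => [[]//|u i] kui; have /words_rcons[ku _] := kui.
rewrite -cats1 takel_cat ?cats1; last by case: ku => ->.
exact: subset_trans (piece_rcons_sub kui) (IH _ ku mk).
Qed.

Lemma J_compact : compact J. Proof. by case: JwP => _ []. Qed.

Lemma piece_closed k u : words n k u -> closed (Jw u).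
Proof. by case: JwP => _ _ H _ _ /H[]. Qed.

Lemma piece_sub k u : words n k u -> Jw u `<=` J.
Proof. by case: JwP => _ _ H _ _ /H[]. Qed.

Lemma J_ball : exists x r, 0 < r /\ forall y, `|y - x| < r -> J y.
Proof.
case: JwP => _ [_ [x]] + _ _ _; rewrite /interior => /nbhs_ballP[r /= r0 xr].
exists x, r; split=> // y yx; apply: xr; rewrite -ball_normE/= distrC//.
Qed.

Local Notation diamJ := (fine (diam J)).

Lemma diam_J : diam J = diamJ%:E.
Proof.
rewrite fineK// ge0_fin_numE ?diam_ge0// diam_bounded//.
exact: compact_bounded J_compact.
Qed.

Lemma diamJ_gt0 : 0 < diamJ.
Proof.
have [x [r [r0 xJ]]] := J_ball.
pose y := x + const_mx (r / 2).
have yx : `|y - x| <= r / 2.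
  apply: norm_le_coord => [|i]; first by rewrite divr_ge0// ltW.
  by rewrite !mxE addrAC subrr add0r ger0_norm// divr_ge0// ltW.
have Jx : J x by apply: xJ; rewrite subrr normr0.
have Jy : J y by apply: xJ; rewrite (le_lt_trans yx)// gtr_pMr// invf_lt1// ltr1n.
rewrite -lte_fin -diam_J; apply: lt_le_trans (edist_le_diam Jx Jy).
rewrite edistC lte_fin; apply: lt_le_trans (norm_le_edist _ _).
apply: lt_le_trans (coord_le_norm _ (Ordinal d0)).
by rewrite !mxE addrAC subrr add0r gtr0_norm// divr_gt0.
Qed.

Lemma diam_piece k u : words n k u -> diam (Jw u) = (C k * diamJ)%:E.
Proof.
elim: k u => [|k IH] u ku.
  move: ku => /words0 ->; rewrite cprod0 mul1r -diam_J.
  by case: JwP => _ _ _ [-> _] _.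
case/lastP: u ku => [[]//|u i] kui; have /words_rcons[ku ik] := kui.
case: JwP => _ _ _ _ H; have [+ _] := H k.+1 u isT ku.
move=> /(_ i ik)[_]; rewrite (IH _ ku) cprodS.
have Cj0 : C k * diamJ != 0 by rewrite gt_eqF// mulr_gt0 ?cprod_gt0 ?diamJ_gt0.
rewrite inver (negbTE Cj0) muleC => /eqP.
by rewrite eqe_pdivrMl// -EFinM => /eqP ->; rewrite mulrAC.
Qed.

(** A piece of level [k] contains a ball whose radius is comparable to [C k]:
the similarity that maps [J] onto it is onto, so that it maps a ball in [J] to
a ball, and it has ratio [C k] as diameters are scaled by [C k]. *)
Lemma ball_in_piece : exists rho : R, 0 < rho /\
  forall k u, words n k u ->
  exists p, Jw u p /\ forall y, `|y - p| < rho * C k -> Jw u y.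
Proof.
have [x0 [r0 [r00 xJ]]] := J_ball.
pose kap : R := Num.sqrt d%:R; have kap0 : 0 < kap by rewrite sqrtr_gt0 ltr0n.
exists (r0 / kap); split; first by rewrite divr_gt0.
move=> k u ku; case: JwP => _ _ _ [_ sim] _.
have [f [[r [rr fr]] Juf]] := sim _ _ ku.
have Jx0 : J x0 by apply: xJ; rewrite subrr normr0.
have Ckr : C k <= r.
  rewrite -(ler_pM2r diamJ_gt0) -lee_fin -(diam_piece ku).
  apply/diam_leP; first by rewrite mulr_ge0 ?ltW ?diamJ_gt0.
  rewrite Juf => _ _ [a Ja <-] [b Jb <-]; rewrite fr ler_pM2l//.
  by rewrite -lee_fin -diam_J edist_le_diam.
exists (f x0); rewrite Juf; split; first by exists x0.
move=> y yx0; have [x xy] := similarity_surj rr fr y.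
exists x => //; apply: xJ; apply: le_lt_trans (norm_le_edist _ _) _.
rewrite -(ltr_pM2l rr) -fr xy; apply: le_lt_trans (edist_le_norm _ _) _.
rewrite -ltr_pdivlMl// (lt_le_trans yx0)// mulrAC mulrC ler_wpM2l//.
  by rewrite invr_ge0 ltW.
by rewrite mulrC ler_wpM2r// ltW.
Qed.

Lemma interior_piece_disjoint k u v : words n k u -> words n k v -> u != v ->
  interior (Jw u) `&` interior (Jw v) = set0.
Proof.
elim: k u v => [|k IH] u v.
  by move=> /words0-> /words0->; rewrite eqxx.
case/lastP: u => [[]//|u i]; case/lastP: v => [_ []//|v l] uik vlk neq.
have /words_rcons[uk ik] := uik; have /words_rcons[vk lk] := vlk.
(* The words differ before the last letter, or only there. *)
have [uv|uv] := eqVneq u v; last first.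
  apply/seteqP; split=> //; rewrite -(IH u v uk vk uv).
  by apply: setISS; apply: interiorS;
    [exact: piece_rcons_sub uik|exact: piece_rcons_sub vlk].
case: JwP => _ _ _ _ H; have [_ +] := H k.+1 u isT uk.
rewrite -uv; apply => // il; move: neq; by rewrite uv il eqxx.
Qed.

Local Notation E :=
  (\bigcap_(k in [set k | (1 <= k)%N]) \bigcup_(u in words n k) Jw u).

Lemma finite_words k : finite_set (words n k).
Proof.
have -> : words n k = [set` word_seq n k].
  by apply/seteqP; split=> u /word_seqP.
exact: finite_seq.
Qed.

Lemma moran_compact : compact E.
Proof.
apply: subclosed_compact J_compact _.
  apply: closed_bigI => k _; apply: closed_bigcup; first exact: finite_words.
  exact: piece_closed.
by move=> x /(_ 1%N isT)[u u1 ux]; exact: piece_sub u1 _ ux.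
Qed.

(** The pieces below [Jw w] indexed by [w1], [w11], and so on are nested and
compact; a common point lies in every generation. *)
Lemma piece_meets_moran k w : words n k w -> Jw w `&` E !=set0.
Proof.
move=> kw; pose v i := w ++ nseq i 1%N.
have vW i : words n (i + k) (v i) by exact: words_cat_nseq1.
have vS i m : (i <= m)%N -> Jw (v m) `<=` Jw (v i).
  move=> im; have -> : v i = take (i + k) (v m).
    rewrite /v take_cat; case: kw => -> _; rewrite ltnNge leq_addl/= addnK.
    by rewrite take_nseq.
  by apply: piece_sub_take (vW m) _; rewrite leq_add2r.
have [rho [_ ne]] := ball_in_piece.
have /choice[x xv] i : exists x, Jw (v i) x.
  by have [p [Jp _]] := ne _ _ (vW i); exists p.
have xF i : \forall m \near \oo, Jw (v i) (x m).
  by exists i => // m /= im; apply: vS im _ (xv m).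
have [|y [_ yx]] := J_compact (F := x @ \oo) _.
  by apply: filterS (xF 0%N) => m; exact: (piece_sub (vW 0%N)).
have yv i : Jw (v i) y.
  by apply: (piece_closed (vW i)) => B yB; apply: yx => //; exact: xF.
exists y; split; first by have := yv 0%N; rewrite /v cats0.
move=> m _; exists (take m (v m)); last first.
  by apply: piece_sub_take (vW m) _ _ (yv m); rewrite leq_addr.
by apply: take_word (vW m); rewrite leq_addr.
Qed.

(** A set of diameter of order [C m] meets, even after enlargement by [C m],
boundedly many pieces of level [m]: these have diameter of order [C m] too, and
contain disjoint balls of radius of order [C m]. *)
Lemma piece_count (cm : R) : 0 < cm -> exists M : nat,
  forall m (U : set 'rV[R]_d) (s : seq (seq nat)),
    (diam U <= (C m / cm)%:E)%E -> uniq s ->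
    {in s, forall u, words n m u /\
       Jw u `&` \bigcup_(x in U) ball x (C m) !=set0} ->
  (size s <= M)%N.
Proof.
move=> cm0; have [rho [rho0 ne]] := ball_in_piece.
have [M MP] := @packing_bound R d (diamJ + 1 + cm^-1) rho rho0.
exists M => m U s dU us sW.
have Cm0 := cprod_gt0 m.
have /choice[p pP] u : exists p, u \in s ->
    Jw u p /\ forall y, `|y - p| < rho * C m -> Jw u y.
  have [/sW[/ne[p pu] _]|_] := boolP (u \in s); first by exists p.
  by exists 0.
case: s => // u0 s in us sW pP *.
have [z Uz] : U !=set0.
  by have [_ [y [_ [z Uz _]]]] := sW u0 (mem_head _ _); exists z.
apply: (MP _ _ p z (C m)) => // [u us'|u v us' vs' uv].
  have [uW [y [Jy [x Ux]]]] := sW u us'; rewrite -ball_normE/= => xy.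
  have [Jp _] := pP u us'.
  have py : `|p u - y| <= diamJ * C m.
    apply: le_trans (norm_le_edist _ _) _; rewrite -lee_fin mulrC.
    by rewrite -(diam_piece uW) edist_le_diam.
  have xz : `|x - z| <= cm^-1 * C m.
    apply: le_trans (norm_le_edist _ _) _; rewrite -lee_fin mulrC.
    by rewrite (le_trans _ dU)// edist_le_diam.
  rewrite -[p u - z](_ : (p u - y) - (x - y) + (x - z) = _); last first.
    by rewrite opprB -!addrA !addKr.
  rewrite !mulrDl mul1r (le_trans (ler_normD _ _))// lerD//.
  by rewrite (le_trans (ler_normB _ _))// lerD// ltW.
rewrite leNgt; apply/negP => puv.
have /(congr1 (fun A => A (p u))) :=
  interior_piece_disjoint (sW u us').1 (sW v vs').1 uv.
suff [iu iv] : interior (Jw u) (p u) /\ interior (Jw v) (p u).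
  by rewrite /= => <-.
have r0 : 0 < rho * C m by rewrite mulr_gt0.
split; rewrite /interior/=.
  apply/nbhs_ballP; exists (rho * C m) => //= y; rewrite -ball_normE/= => py.
  by apply: (pP u us').2; rewrite distrC.
have : nbhs (p u) (ball (p v) (rho * C m)).
  apply: open_nbhs_nbhs; split; first exact: ball_open.
  by rewrite -ball_normE/= distrC.
apply: filterS => y; rewrite -ball_normE/= => vy.
by apply: (pP v vs').2; rewrite distrC.
Qed.

(** * Mass of the sets of a cover *)

(** The uniform mass distribution on [E] gives each piece of level [m] the mass
[1 / N m], so a set of diameter of order [C m] has mass of order at most
[1 / N m], and the masses of the sets of a cover add up to at least 1.  By
compactness finitely many enlarged sets cover [E], so that masses are read off
from the words of one level [K] beyond all the levels in play. *)
Lemma mass_bound (cm : R) : 0 < cm -> exists M : R, 0 < M /\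
  forall (D : set nat) (U : nat -> set 'rV[R]_d) (m : nat -> nat),
    is_cover E D U ->
    (forall i, D i -> (diam (U i) <= (C (m i) / cm)%:E)%E) ->
  (1 <= M%:E * \esum_(i in D) ((N (m i))%:R^-1)%:E)%E.
Proof.
move=> cm0; have [M MP] := piece_count cm0.
exists M.+1%:R; split=> // D U m EDU dU.
pose V i := \bigcup_(x in U i) ball x (C (m i)).
have oV i : D i -> open (V i).
  by move=> _; apply: bigcup_open => x _; exact: ball_open.
have EV : E `<=` cover D V.
  move=> x /EDU[i Di Ux]; exists i => //; exists x => //.
  exact/ballxx/cprod_gt0.
have := moran_compact; rewrite compact_cover => /(_ _ _ _ oV EV)[F FD EF].
pose K := \max_(i <- enum_fset F) m i.
have mK i : i \in F -> (m i <= K)%N by move=> iF; exact: leq_bigmax_seq.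
(* Every word of level K extends a word of some [hits i], as its piece meets E. *)
pose hits i := [seq u <- word_seq n (m i) | `[< Jw u `&` V i !=set0 >]].
have hitsM i : i \in F -> (size (hits i) <= M)%N.
  move=> iF; apply: (MP (m i) (U i)) => [||u].
  - by apply: dU; rewrite -in_setE; exact: FD.
  - by rewrite filter_uniq// word_seq_uniq.
  - by rewrite mem_filter => /andP[/asboolP uV /word_seqP].
have NK : (N K <= \sum_(i <- enum_fset F)
    count (fun w => take (m i) w \in hits i) (word_seq n K))%N.
  apply: leq_trans (count_has_sum _ _ _).
  rewrite -size_word_seq eq_leq//; apply/esym/eqP; rewrite -all_count.
  apply/allP => w /word_seqP wK.
  have [x [Jx Ex]] := piece_meets_moran wK.
  have [i /= iF Vx] := EF _ Ex; apply/hasP; exists i => //.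
  rewrite mem_filter; apply/andP; split; last first.
    by apply/word_seqP; apply: take_word wK; exact: mK.
  by apply/asboolP; exists x; split=> //; exact: piece_sub_take wK (mK _ iF) _ Jx.
have cntN i : i \in F ->
    (count (fun w => take (m i) w \in hits i) (word_seq n K))%:R <=
    M%:R * ((N K)%:R / (N (m i))%:R) :> R.
  move=> iF; rewrite mulrA ler_pdivlMr ?ltr0n ?nprod_gt0// -!natrM ler_nat.
  apply: (@leq_trans (size (hits i) * N K)); last by rewrite leq_mul2r hitsM ?orbT.
  rewrite (eq_count (a2 := fun w => has (fun u => take (m i) w == u) (hits i)));
    last first.
    by move=> w; rewrite -has_pred1; apply: eq_has => u /=; rewrite eq_sym.
  apply: leq_trans (leq_mul (count_has_sum _ _ _) (leqnn _)) _.
  rewrite big_distrl/= -sum1_size big_distrl/=; apply: leq_sum => u _.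
  by rewrite mul1n count_extensions// mK.
have NK0 : 0 < (N K)%:R :> R by rewrite ltr0n nprod_gt0.
have le1 : 1 <= M%:R * \sum_(i <- enum_fset F) (N (m i))%:R^-1 :> R.
  rewrite -(ler_pM2r NK0) mul1r mulrAC mulr_sumr.
  apply: (@le_trans _ _ (\sum_(i <- enum_fset F)
    count (fun w => take (m i) w \in hits i) (word_seq n K))%:R).
    by rewrite ler_nat.
  rewrite natr_sum big_seq [leRHS]big_seq; apply: ler_sum => i iF.
  by rewrite -mulrA cntN.
have sum0 : 0 <= \sum_(i <- enum_fset F) (N (m i))%:R^-1 :> R by exact: sumr_ge0.
apply: (@le_trans _ _ (M.+1%:R * \sum_(i <- enum_fset F) (N (m i))%:R^-1)%:E).
  by rewrite lee_fin (le_trans le1)// ler_wpM2r// ler_nat.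
rewrite EFinM lee_wpmul2l//; apply: esum_ge; exists [set` F].
  by split; [exact: finite_fset|move=> i /FD; rewrite in_setE].
by rewrite -fsbig_seq ?fset_uniq// sumEFin.
Qed.

(** * Covers by pieces of one level *)

Lemma ln_nprod_cprod m t : (0 < m)%N ->
  ln ((N m)%:R * C m `^ t) = (log_ratio n c m - t) * - ln (C m).
Proof.
move=> m0; have lC : ln (C m) < 0 by rewrite ln_lt0// cprod_gt0 cprod_lt1.
rewrite lnM ?posrE ?ltr0n ?nprod_gt0 ?powR_gt0 ?cprod_gt0// ln_powR /log_ratio.
by field; rewrite lt_eqF.
Qed.

Lemma log_ratio_lt m t : (0 < m)%N ->
  (log_ratio n c m < t) = ((N m)%:R * C m `^ t < 1).
Proof.
move=> m0; have lC : 0 < - ln (C m).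
  by rewrite oppr_gt0 ln_lt0// cprod_gt0 cprod_lt1.
have NC : 0 < (N m)%:R * C m `^ t.
  by rewrite mulr_gt0 ?ltr0n ?nprod_gt0 ?powR_gt0 ?cprod_gt0.
rewrite -[RHS]ltr_ln ?posrE ?ltr01// ln1 ln_nprod_cprod//.
by rewrite pmulr_llt0// subr_lt0.
Qed.

Lemma log_ratio_gt m t : (0 < m)%N ->
  (t < log_ratio n c m) = (1 < (N m)%:R * C m `^ t).
Proof.
move=> m0; have lC : 0 < - ln (C m).
  by rewrite oppr_gt0 ln_lt0// cprod_gt0 cprod_lt1.
have NC : 0 < (N m)%:R * C m `^ t.
  by rewrite mulr_gt0 ?ltr0n ?nprod_gt0 ?powR_gt0 ?cprod_gt0.
rewrite -[RHS]ltr_ln ?posrE ?ltr01// ln1 ln_nprod_cprod//.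
by rewrite pmulr_lgt0// subr_gt0.
Qed.

Lemma log_ratio_ge0 m : 0 <= log_ratio n c m.
Proof.
rewrite /log_ratio -mulrN mulr_ge0//; first by rewrite ln_ge0// ler1n nprod_gt0.
rewrite -invrN invr_ge0 oppr_ge0 ln_le0// -cprod0.
exact: cprod_le.
Qed.

Lemma cover_sum_const k (U : nat -> set 'rV[R]_d) b s :
  (forall i, (i < k)%N -> diam (U i) = b%:E) ->
  cover_sum s `I_k U = (k%:R * b `^ s)%:E.
Proof.
move=> Ub; rewrite /cover_sum (eq_esum (b := fun=> (b `^ s)%:E)); last first.
  by move=> i /Ub ->; rewrite poweR_EFin.
rewrite esum_fset ?finite_II//; last by move=> i _; rewrite lee_fin powR_ge0.
rewrite -(fsbig_ord _ _ (fun=> (b `^ s)%:E)) sumEFin.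
by rewrite sumr_const card_ord mulr_natl.
Qed.

(** A cube of diameter [kappa * C m] centred at a point of a piece of level [m]
contains that piece. *)
Local Notation kappa := (2 * Num.sqrt d%:R * diamJ).

Lemma kappa_gt0 : 0 < kappa.
Proof. by rewrite !mulr_gt0 ?diamJ_gt0// sqrtr_gt0 ltr0n. Qed.

(** All sets of the cover have the same prescribed diameter [b], which is what
makes these covers admissible at every scale. *)
Lemma cube_cover m b : (0 < m)%N -> kappa * C m <= b ->
  exists U : nat -> set 'rV[R]_d, is_cover E `I_(N m) U /\
    forall i, diam (U i) = b%:E.
Proof.
move=> m0 kb; pose h := b / (2 * Num.sqrt d%:R).
have sd0 : 0 < Num.sqrt d%:R :> R by rewrite sqrtr_gt0 ltr0n.
have jh : C m * diamJ <= h.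
  rewrite /h ler_pdivlMr ?mulr_gt0// (le_trans _ kb)// le_eqVlt.
  by apply/orP; left; apply/eqP; ring.
have h0 : 0 <= h by rewrite (le_trans _ jh)// mulr_ge0// ltW ?cprod_gt0 ?diamJ_gt0.
have [rho [_ ne]] := ball_in_piece.
have /choice[p pP] u : exists p, words n m u -> Jw u p.
  by have [/ne[p [up _]]|nu] := pselect (words n m u); [exists p|exists 0].
pose z i := p (nth [::] (word_seq n m) i).
exists (fun i => [set x | `|x - z i| <= h]); split=> [x /(_ m m0)[u mu ux]|i].
  have us : u \in word_seq n m by exact/word_seqP.
  exists (index u (word_seq n m)); first by rewrite /= -size_word_seq index_mem.
  rewrite /= /z nth_index//; apply: le_trans (norm_le_edist _ _) _.
  rewrite (le_trans _ jh)// -lee_fin -(diam_piece mu).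
  by rewrite edist_le_diam//; exact: pP.
by rewrite diam_cube//; congr (_%:E); rewrite /h; field; rewrite gt_eqF.
Qed.

(** The sum is [N m * b ^ s], at most
[Q ^ s * (N m * C m ^ t) * C m ^ (s - t)], whose middle factor is less than 1
and whose last factor tends to 0. *)
Lemma small_cover (Q s t eps : R) : 0 <= Q -> 0 <= s -> t < s -> 0 < eps ->
  exists K, forall m b, (K <= m)%N -> (0 < m)%N -> log_ratio n c m < t ->
    kappa * C m <= b <= Q * C m ->
  exists (D : set nat) (U : nat -> set 'rV[R]_d),
    [/\ is_cover E D U, forall i, diam (U i) = b%:E &
        (cover_sum s D U <= eps%:E)%E].
Proof.
move=> Q0 s0 ts eps0; have st0 : 0 < s - t by rewrite subr_gt0.
have Q1 : 0 < Q `^ s + 1 by rewrite ltr_wpDl ?powR_ge0.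
(* Solves [Q ^ s * eta ^ (s - t) <= eps], with room for [Q = 0]. *)
pose eta := (eps / (Q `^ s + 1)) `^ (s - t)^-1.
have eta0 : 0 < eta by rewrite powR_gt0// divr_gt0.
have [K KP] := cprod_small eta0.
exists K => m b Km m0 mt /andP[kb bQ]; have [U [EU Ub]] := cube_cover m0 kb.
exists `I_(N m), U; split=> //; rewrite (@cover_sum_const _ _ b)// lee_fin.
have C0 := cprod_gt0 m.
have b0 : 0 <= b by rewrite (le_trans _ kb)// mulr_ge0 ?(ltW kappa_gt0) ?(ltW C0).
apply: (@le_trans _ _ ((N m)%:R * (Q * C m) `^ s)).
  by rewrite ler_wpM2l// ge0_ler_powR ?nnegrE ?mulr_ge0// ltW.
rewrite powRM ?(ltW C0)// -[in C m `^ s](subrK t s) powRD; last first.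
  by rewrite (gt_eqF C0) implybT.
have Ceta : C m `^ (s - t) <= eps / (Q `^ s + 1).
  have <- : eta `^ (s - t) = eps / (Q `^ s + 1).
    by rewrite -powRrM mulVf ?lt0r_neq0// powRr1// divr_ge0 ?ltW.
  by apply: ge0_ler_powR; rewrite ?nnegrE ltW//; exact: KP.
have -> : (N m)%:R * (Q `^ s * (C m `^ (s - t) * C m `^ t)) =
    ((N m)%:R * C m `^ t) * (Q `^ s * C m `^ (s - t)) by ring.
apply: (@le_trans _ _ (1 * (Q `^ s * (eps / (Q `^ s + 1))))).
  rewrite ler_pM ?mulr_ge0 ?powR_ge0//; last by rewrite ler_wpM2l ?powR_ge0.
  by rewrite ltW// -log_ratio_lt.
rewrite mul1r mulrCA ger_pMr// ler_pdivrMr// mul1r lerDl//.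
Qed.

Lemma scale_pow_le delta theta : 0 < delta <= 1 -> 0 <= theta <= 1 ->
  scale_pow delta theta <= delta :> R.
Proof.
move=> /[dup] d01 /andP[dl0 _] /andP[th0 th1]; rewrite /scale_pow.
have [//|th] := eqVneq theta 0; first by rewrite ltW.
by rewrite ge1r_powR// invf_ge1// lt_neqAle eq_sym th.
Qed.

Lemma lower_covers theta s t : 0 <= theta <= 1 -> 0 <= s -> t < s ->
    (forall K, exists2 k, (K <= k)%N & log_ratio n c k < t) ->
  forall eps Delta : R, 0 < eps -> 0 < Delta ->
    exists delta : R, 0 < delta <= Delta /\
    exists (D : set nat) (U : nat -> set 'rV[R]_d),
      theta_cover theta delta E D U /\ (cover_sum s D U <= eps%:E)%E.
Proof.
move=> th01 s0 ts io eps Delta eps0 Delta0.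
have [K KP] := small_cover (ltW kappa_gt0) s0 ts eps0.
have eta0 : 0 < Num.min Delta 1 / kappa.
  by rewrite divr_gt0 ?kappa_gt0// lt_min Delta0 ltr01.
have [K' K'P] := cprod_small eta0.
have [k] := io (maxn 1 (maxn K K')).
rewrite !geq_max => /and3P[k0 Kk K'k] kt.
have := K'P _ K'k; rewrite ltr_pdivlMr ?kappa_gt0// lt_min mulrC => /andP[bD b1].
have b0 : 0 < kappa * C k by rewrite mulr_gt0 ?kappa_gt0 ?cprod_gt0.
have [|D [U [EU Ub US]]] := KP k (kappa * C k) Kk k0 kt; first by rewrite lexx.
exists (kappa * C k); split; first by rewrite b0 ltW.
exists D, U; split=> //; split=> // i Di; rewrite Ub !lee_fin lexx.
by rewrite scale_pow_le// b0 ltW.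
Qed.

Variable cm : R.
Hypotheses (cm0 : 0 < cm) (cmP : forall k, (0 < k)%N -> cm <= c k).

(** * Choice of levels *)

Lemma level_exists (x : R) : 0 < x < 1 ->
  exists l, (0 < l)%N /\ C l <= x < C l.-1.
Proof.
move=> /andP[x0 x1]; have [K KP] := cprod_small x0.
have ex : exists l, C l <= x by exists K; rewrite ltW// KP.
case: (ex_minnP ex) => -[|l] Cl lmin.
  by move: Cl; rewrite cprod0 leNgt x1.
exists l.+1; split=> //; rewrite Cl/= ltNge; apply/negP => /lmin.
by rewrite ltnn.
Qed.

Lemma cprod_le_inv k l : C k <= C l -> (l <= k)%N.
Proof.
move=> kl; rewrite leqNgt; apply/negP => lt_kl.
by have := le_lt_trans (le_trans kl (cprod_le lt_kl)) (cprod_ltS k);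
  rewrite ltxx.
Qed.

Lemma cprod_pred_le l : (0 < l)%N -> C l.-1 <= C l / cm.
Proof.
case: l => // l _; rewrite ler_pdivlMr// cprodS/= ler_wpM2l ?cmP//.
by rewrite ltW// cprod_gt0.
Qed.

Lemma lindexP k theta : (0 < k)%N -> 0 < theta ->
  (0 < lindex c k theta)%N /\
  C (lindex c k theta) <= C k `^ theta^-1 < C (lindex c k theta).-1.
Proof.
move=> k0 th0.
have x01 : 0 < C k `^ theta^-1 < 1.
  rewrite powR_gt0 ?cprod_gt0//=.
  have <- : 1 `^ theta^-1 = 1 :> R by rewrite powR1.
  by rewrite gt0_ltr_powR ?nnegrE ?invr_gt0 ?ltW ?cprod_gt0 ?cprod_lt1.
have [l [_ ll]] := level_exists x01.
rewrite /lindex; case: xgetP => [l' -> /= ll'|/(_ l)//].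
split=> //; rewrite lt0n; apply/eqP => l'0; move: ll'; rewrite l'0/=.
by move=> /andP[/le_lt_trans h /h]; rewrite ltxx.
Qed.

(** Given [delta], the level [k] is the first one whose pieces fit in cubes of
diameter [delta]; a level [m] between [k] and [lindex c k theta] then has pieces
that fit in cubes of diameter [b], the larger of [kappa * C m] and
[delta ^ (1 / theta)], and [b] is still of order [C m]. *)
Lemma upper_covers theta s t : 0 < theta <= 1 -> 0 <= s -> t < s ->
    (exists K, forall k, (K <= k)%N ->
       exists2 m, (k <= m <= lindex c k theta)%N & log_ratio n c m < t) ->
  forall eps : R, 0 < eps ->
    exists Delta : R, 0 < Delta /\
    forall delta : R, 0 < delta <= Delta ->
    exists (D : set nat) (U : nat -> set 'rV[R]_d),
      theta_cover theta delta E D U /\ (cover_sum s D U <= eps%:E)%E.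
Proof.
move=> /andP[th0 th1] s0 ts [K0 K0P] eps eps0.
have ka0 := kappa_gt0.
(* As [delta] is at most [kappa / cm * C k] and [C k ^ (1 / theta)] at most
   [C m / cm], the least diameter allowed is at most [q * C m]. *)
pose q := (kappa / cm) `^ theta^-1 / cm.
have q0 : 0 <= q by rewrite divr_ge0 ?powR_ge0// ltW.
have Q0 : 0 <= kappa + q by rewrite addr_ge0// ltW.
have [K KP] := small_cover Q0 s0 ts eps0.
pose L := maxn 1 (maxn K K0).
exists (Num.min 1 (kappa * C L)); split.
  by rewrite lt_min ltr01 mulr_gt0// cprod_gt0.
move=> delta; rewrite le_min => /and3P[dl0 dl1 dlL].
have xL : delta / kappa <= C L by rewrite ler_pdivrMr// mulrC.
have [k [k0 /andP[kx xk]]] : exists k, (0 < k)%N /\ C k <= delta / kappa < C k.-1.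
  apply: level_exists; rewrite divr_gt0//= (le_lt_trans xL)// cprod_lt1//.
  by rewrite leq_max.
have := cprod_le_inv (le_trans kx xL).
rewrite !geq_max => /and3P[_ Kk K0k].
have [m /andP[km ml] mt] := K0P k K0k.
have m0 : (0 < m)%N := leq_trans k0 km.
have [l0 /andP[lk kl]] := lindexP k0 th0.
have sp : scale_pow delta theta = delta `^ theta^-1.
  by rewrite /scale_pow gt_eqF.
have kCm : kappa * C m <= delta.
  rewrite mulrC -ler_pdivlMr// (le_trans _ kx)// cprod_le//.
have spq : scale_pow delta theta <= q * C m.
  have dk : delta <= kappa / cm * C k.
    move: xk; rewrite ltr_pdivrMr// => /ltW /le_trans; apply.
    have -> : kappa / cm * C k = C k / cm * kappa by ring.
    by rewrite ler_wpM2r ?cprod_pred_le// ltW.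
  have kc0 : 0 <= kappa / cm by rewrite divr_ge0// ltW.
  have Ck0 := ltW (cprod_gt0 k).
  rewrite sp (@le_trans _ _ ((kappa / cm * C k) `^ theta^-1))//.
    have dl0' := ltW dl0; have th0' := ltW th0.
    by apply: ge0_ler_powR; rewrite ?nnegrE ?invr_ge0//; exact: mulr_ge0.
  rewrite powRM// /q -[leRHS]mulrA ler_wpM2l ?powR_ge0//.
  rewrite (le_trans (ltW kl))// (le_trans (cprod_pred_le l0))// mulrC.
  by rewrite ler_wpM2l ?invr_ge0 ?(ltW cm0)// cprod_le.
pose b := Num.max (kappa * C m) (scale_pow delta theta).
have kC0 : 0 <= kappa * C m by rewrite ltW// mulr_gt0// cprod_gt0.
have bQ : kappa * C m <= b <= (kappa + q) * C m.
  rewrite (mulrDl kappa q); apply/andP; split; first by rewrite /b le_max lexx.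
  rewrite /b ge_max; apply/andP; split; last by rewrite ler_wpDl.
  by rewrite ler_wpDr// mulr_ge0// ltW// cprod_gt0.
have [D [U [EU Ub US]]] := KP m b (leq_trans Kk km) m0 mt bQ.
exists D, U; split=> //; split=> // i Di; rewrite Ub !lee_fin le_max lexx orbT.
by rewrite ge_max kCm scale_pow_le// ?dl0 ?dl1// (ltW th0).
Qed.

(** * Lower bounds for the sums over a cover *)

(** The mass of a piece is at most the [s]-th power of the diameter of the sets
measured at its level. *)
Lemma inv_nprod_le_powR m (r s : R) : (0 < m)%N -> 0 <= s ->
  s < log_ratio n c m -> C m <= r -> (N m)%:R^-1 <= r `^ s.
Proof.
move=> m0 s0 sm Cr; have C0 := ltW (cprod_gt0 m).
apply: (@le_trans _ _ (C m `^ s)); last first.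
  by rewrite ge0_ler_powR ?nnegrE// (le_trans C0).
by rewrite -[leLHS]mul1r ler_pdivrMr ?ltr0n ?nprod_gt0// mulrC ltW// -log_ratio_gt.
Qed.

(** At the scale [delta = C k], sets of diameter between [delta ^ (1 / theta)] and
[delta] are measured at levels between [k] and [lindex c k theta], where the
log-ratio exceeds [s]; so the [s]-sums of admissible covers are bounded below. *)
Lemma no_upper_cover (theta s : R) : 0 < theta -> 0 <= s ->
    (forall K, exists2 k, (K <= k)%N &
       forall m, (k <= m <= lindex c k theta)%N -> s < log_ratio n c m) ->
  ~ (forall eps : R, 0 < eps ->
    exists Delta : R, 0 < Delta /\
    forall delta : R, 0 < delta <= Delta ->
    exists (D : set nat) (U : nat -> set 'rV[R]_d),
      theta_cover theta delta E D U /\ (cover_sum s D U <= eps%:E)%E).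
Proof.
move=> th0 s0 io up; have [M [M0 MP]] := mass_bound cm0.
have [|Delta [Delta0 DP]] := up ((2 * M)^-1); first by rewrite invr_gt0 mulr_gt0.
have [K KP] := cprod_small Delta0.
have [k] := io (maxn 1 K); rewrite geq_max => /andP[k0 Kk] ks.
have [|D [U [[EU dU] US]]] := DP (C k); first by rewrite cprod_gt0 ltW// KP.
have [l0 /andP[lk kl]] := lindexP k0 th0.
have /choice[m mP] i : exists m, D i -> (diam (U i) <= (C m / cm)%:E)%E /\
    (((N m)%:R^-1)%:E <= diam (U i) `^ s)%E.
  have [Di|nD] := pselect (D i); last by exists 0%N.
  have [] := dU i Di; rewrite /scale_pow gt_eqF//.
  case: (diam (U i)) => [r| |]//; rewrite !lee_fin => Cr rC.
  have Ck1 := cprod_lt1 k0.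
  have [|m [m0 /andP[mr rm]]] := @level_exists r.
    by rewrite (le_lt_trans rC)// (lt_le_trans _ Cr)// powR_gt0// cprod_gt0.
  exists m => _; rewrite lee_fin (le_trans (ltW rm)) ?cprod_pred_le//.
  split=> //; rewrite poweR_EFin lee_fin inv_nprod_le_powR// ks//.
  rewrite (cprod_le_inv (le_trans mr rC))/= leqNgt; apply/negP => lm.
  have : C m.-1 <= C (lindex c k theta) by rewrite cprod_le// -ltnS prednK.
  by move/(le_trans)/(_ lk)/(le_trans)/(_ Cr); rewrite leNgt rm.
have := MP D U m EU (fun i Di => (mP i Di).1); apply/negP; rewrite -ltNge.
apply: (@le_lt_trans _ _ (M%:E * (2 * M)^-1%:E)%E); last first.
  rewrite -EFinM lte_fin invfM mulrCA divff ?gt_eqF// mulr1 invf_lt1// ltr1n//.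
rewrite lee_pmul2l//; apply: le_trans US; apply: le_esum => i Di.
exact: (mP i Di).2.
Qed.

(** The sets of diameter 0 in a cover have no level of their own; they are measured
at levels so large that their total mass is negligible. *)
Lemma hausdorff_measure_neq0 s : 0 <= s ->
    (exists K, forall k, (K <= k)%N -> s < log_ratio n c k) ->
  hausdorff_measure s E <> 0%E.
Proof.
move=> s0 [K KP] H0; have [M [M0 MP]] := mass_bound cm0.
(* The s-sum of the cover and the total mass of its singletons each contribute
   at most [e], so that the mass accounted for is at most [2 * M * e = 1 / 2]. *)
pose e := (4 * M)^-1; have e0 : 0 < e by rewrite invr_gt0 mulr_gt0.
pose L := K.+1.
have pre0 : (hausdorff_premeasure s (C L) E <= 0)%E.
  by rewrite -H0; apply: ereal_sup_ubound; exists (C L) => //; exact: cprod_gt0.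
have : (hausdorff_premeasure s (C L) E < e%:E)%E.
  by rewrite (le_lt_trans pre0) ?lte_fin.
move=> /ereal_inf_lt[_ [D [U [EU dU ->]]] US].
have /choice[m mP] i : exists m, D i -> (diam (U i) <= (C m / cm)%:E)%E /\
    (((N m)%:R^-1)%:E <= diam (U i) `^ s + (e / (2 ^ i.+1)%:R)%:E)%E.
  have [Di|nD] := pselect (D i); last by exists 0%N.
  have := dU i Di; have := diam_ge0 (U i).
  case: (diam (U i)) => [r| |]//; rewrite !lee_fin le_eqVlt => /predU1P[<-|r0] rC.
    have [k kP] : exists k : nat, e^-1 <= 2 ^+ k.
      exists (Num.bound e^-1); apply/ltW; exact: upper_nthrootP.
    exists (k + i.+1)%N => _; rewrite lee_fin.
    rewrite divr_ge0 ?(ltW cm0) ?(ltW (cprod_gt0 _))//.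
    split=> //; apply: (@le_trans _ _ (e / (2 ^ i.+1)%:R)%:E); last first.
      by rewrite leeDr// poweR_ge0.
    rewrite lee_fin -[leLHS]mul1r ler_pdivrMr ?ltr0n ?nprod_gt0//.
    apply: (@le_trans _ _ (e / (2 ^ i.+1)%:R * 2 ^+ (k + i.+1))).
      rewrite natrX exprD mulrA mulrAC divfK ?expf_neq0 ?pnatr_eq0//.
      by rewrite -ler_pdivrMl// mulr1.
    by rewrite ler_wpM2l ?divr_ge0 ?(ltW e0)// -natrX ler_nat nprod_ge.
  have [|m [m0 /andP[mr rm]]] := @level_exists r.
    by rewrite r0 (le_lt_trans rC)// cprod_lt1.
  exists m => _; rewrite lee_fin (le_trans (ltW rm)) ?cprod_pred_le//.
  split=> //; rewrite poweR_EFin -EFinD lee_fin ler_wpDr//.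
    by rewrite divr_ge0 ?(ltW e0).
  apply: inv_nprod_le_powR => //; apply: KP; apply: ltnW.
  exact: cprod_le_inv (le_trans mr rC).
have := MP D U m EU (fun i Di => (mP i Di).1); apply/negP; rewrite -ltNge.
apply: (@le_lt_trans _ _ (M%:E * (e%:E + e%:E))%E); last first.
  rewrite -EFinD -EFinM lte_fin /e; have -> : M * ((4 * M)^-1 + (4 * M)^-1) = 2^-1.
    by field; rewrite gt_eqF.
  by rewrite invf_lt1// ltr1n.
rewrite lee_pmul2l//.
have DE : D = [set x | x \in D] by apply/seteqP; split=> x; rewrite /= in_setE.
rewrite [X in esum X _]DE.
apply: (@le_trans _ _ (\esum_(i in [set x | x \in D])
  (diam (U i) `^ s + (e / (2 ^ i.+1)%:R)%:E))%E).
  by apply: le_esum => i /=; rewrite in_setE => Di; exact: (mP i Di).2.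
rewrite -nneseries_esum; last first.
  by move=> i _; rewrite adde_ge0 ?poweR_ge0// lee_fin divr_ge0// ltW.
apply: le_trans (epsilon_trick _ (fun i => poweR_ge0 _ _) (ltW e0)) _.
rewrite leeD2r// nneseries_esum; last by move=> i _; exact: poweR_ge0.
by rewrite ltW//; move: US; rewrite /cover_sum [X in esum X _]DE.
Qed.

End moran.

(** * Limits superior and inferior, and thresholds *)

Lemma limn_esup_lt (R : realType) (u : (\bar R)^nat) (x : \bar R) :
  (limn_esup u < x)%E -> exists K, forall k, (K <= k)%N -> (u k < x)%E.
Proof.
move=> /ereal_inf_lt[_ [V [K _ KV] <-]] Vx; exists K => k Kk.
apply: le_lt_trans Vx; apply: ereal_sup_ubound; exists k => //.
by apply: KV; rewrite /= Kk.
Qed.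

Lemma limn_esup_gt (R : realType) (u : (\bar R)^nat) (x : \bar R) :
  (x < limn_esup u)%E -> forall K, exists2 k, (K <= k)%N & (x < u k)%E.
Proof.
move=> xu K; apply: contrapT => nk; move: xu; apply/negP; rewrite -leNgt.
apply: ge_ereal_inf; exists (ereal_sup (u @` [set k | (K <= k)%N])).
  by exists [set k | (K <= k)%N] => //; exists K.
apply: ge_ereal_sup => _ [k /= Kk <-]; rewrite leNgt; apply/negP => xk.
by apply: nk; exists k.
Qed.

Lemma limn_einf_gt (R : realType) (u : (\bar R)^nat) (x : \bar R) :
  (x < limn_einf u)%E -> exists K, forall k, (K <= k)%N -> (x < u k)%E.
Proof.
rewrite /limn_einf lteNr => /limn_esup_lt[K KP].
by exists K => k /KP; rewrite lteN2.
Qed.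

Lemma limn_einf_lt (R : realType) (u : (\bar R)^nat) (x : \bar R) :
  (limn_einf u < x)%E -> forall K, exists2 k, (K <= k)%N & (u k < x)%E.
Proof.
rewrite /limn_einf lteNl => /limn_esup_gt ux K; have [k Kk] := ux K.
by rewrite lteN2; exists k.
Qed.

Lemma ereal_inf_le_threshold (R : realType) (P : R -> Prop) (L : \bar R) :
  (0 <= L)%E ->
  (forall s t : R, 0 <= s -> t < s -> (L < t%:E)%E -> P s) ->
  (ereal_inf [set s%:E | s in [set s : R | (0 <= s)%R /\ P s]] <= L)%E.
Proof.
move=> L0 LP; case: L L0 LP => [l| |]//; last by move=> *; exact: leey.
rewrite lee_fin => l0 LP; apply/lee_addgt0Pr => e e0.
apply: ereal_inf_lbound; exists (l + e) => //; split; first by rewrite addr_ge0// ltW.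
apply: (LP _ (l + e / 2)); first by rewrite addr_ge0// ltW.
  by rewrite ltrD2l gtr_pMr// invf_lt1// ltr1n.
by rewrite lte_fin ltrDl divr_gt0.
Qed.

Lemma ereal_inf_ge_threshold (R : realType) (P : R -> Prop) (L : \bar R) :
  (forall s : R, 0 <= s -> (s%:E < L)%E -> ~ P s) ->
  (L <= ereal_inf [set s%:E | s in [set s : R | (0 <= s)%R /\ P s]])%E.
Proof.
move=> LP; apply: le_ereal_inf_tmp => _ [s [s0 Ps] <-].
by rewrite leNgt; apply/negP => /(LP s s0).
Qed.

(** * The dimensions of a homogeneous Moran set *)

Theorem corollary1p3 (R : realType) (d : nat) (n : nat -> nat) (c : nat -> R)
    (E : set 'rV[R]_d) (hd : (1 <= d)%N)
    (hE : homogeneous_moran_set n c E)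
    (hc : 0 < inf [set c k | k in [set k | (1 <= k)%N]]) :
  (forall theta : R, 0 < theta <= 1 ->
     upper_intermediate_dim theta E =
     limn_esup (fun k =>
       \big[mine/+oo%E]_(k <= m < (lindex c k theta).+1) (log_ratio n c m)%:E))
  /\
  (forall theta : R, 0 <= theta <= 1 ->
     lower_intermediate_dim theta E =
       limn_einf (fun k => (log_ratio n c k)%:E) /\
     limn_einf (fun k => (log_ratio n c k)%:E) = hausdorff_dim E).
Proof.
case: hE => [J [Jw [JwP ->]]] {E}.
set E := \bigcap_(k in _) _; set cm := inf _ in hc.
have cmP k : (0 < k)%N -> cm <= c k.
  move=> k0; apply: ge_inf; last by exists k.
  by exists 0 => _ [i /= i0 <-]; rewrite ltW// (c_gt0 JwP).
have rho0 m : (0 <= (log_ratio n c m)%:E)%E.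
  by rewrite lee_fin (log_ratio_ge0 JwP).
split=> theta.
  move=> /[dup] th01 /andP[th0 _].
  set v := (fun k : nat => \big[mine/+oo%E]_(k <= m < _) _).
  have v_gt k m x : (x < v k)%E -> (k <= m <= lindex c k theta)%N ->
      (x < (log_ratio n c m)%:E)%E.
    move=> xv km; apply: lt_le_trans xv _.
    by apply: ge_bigmin_seq => //; rewrite mem_index_iota ltnS.
  have v_lt k x : (v k < x)%E ->
      exists2 m, (k <= m <= lindex c k theta)%N & ((log_ratio n c m)%:E < x)%E.
    move=> vx; apply: contrapT => nm; move: vx; apply/negP; rewrite -leNgt.
    rewrite /v big_nat; apply: le_bigmin => [|m km]; first exact: leey.
    by rewrite leNgt; apply/negP => mx; apply: nm; exists m.
  have v0 k : (0 <= v k)%E by apply: le_bigmin => //; exact: leey.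
  apply/eqP; rewrite eq_le; apply/andP; split.
    apply: ereal_inf_le_threshold.
      rewrite leNgt; apply/negP => /limn_esup_lt[K /(_ K (leqnn K))].
      by rewrite ltNge v0.
    move=> s t s0 ts /limn_esup_lt[K KP].
    apply: (upper_covers hd JwP hc cmP th01 s0 ts); exists K => k /KP /v_lt[m km].
    by rewrite lte_fin; exists m.
  apply: ereal_inf_ge_threshold => s s0 /limn_esup_gt io.
  apply: (no_upper_cover hd JwP hc cmP th0 s0) => K.
  by have [k Kk sk] := io K; exists k => // m /(v_gt _ _ _ sk); rewrite lte_fin.
move=> th01; set L := limn_einf _.
have L_le_H : (L <= hausdorff_dim E)%E.
  apply: ereal_inf_ge_threshold => s s0 /limn_einf_gt[K KP].
  apply: (hausdorff_measure_neq0 hd JwP hc cmP s0); exists K => k /KP.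
  by rewrite lte_fin.
have lower_le_L : (lower_intermediate_dim theta E <= L)%E.
  apply: ereal_inf_le_threshold.
    rewrite leNgt; apply/negP => /limn_einf_lt/(_ 0%N)[k _].
    by rewrite ltNge rho0.
  move=> s t s0 ts /limn_einf_lt io; apply: (lower_covers hd JwP th01 s0 ts) => K.
  by have [k Kk] := io K; rewrite lte_fin; exists k.
have H_le_lower : (hausdorff_dim E <= lower_intermediate_dim theta E)%E.
  apply: ereal_inf_le_tmp => _ [s [s0 sP] <-]; exists s => //; split=> //.
  apply/eqP; rewrite eq_le; apply/andP; split.
    apply: ge_ereal_sup => _ [delta /= delta0 <-].
    apply/lee_addgt0Pr => e e0; rewrite add0e.
    have [eta [/andP[_ ed] [D [U [[EU dU] US]]]]] := sP e delta e0 delta0.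
    apply: le_trans US; apply: ereal_inf_lbound; exists D, U; split=> // i /dU[_].
    by move=> /le_trans; apply; rewrite lee_fin.
  apply: le_ereal_sup_tmp; exists (hausdorff_premeasure s 1 E).
    by exists 1 => //=; exact: ltr01.
  apply: le_ereal_inf_tmp => _ [D [U [_ _ ->]]].
  by apply: esum_ge0 => i _; exact: poweR_ge0.
split; apply/eqP; rewrite eq_le; apply/andP; split=> //.
- exact: le_trans L_le_H H_le_lower.
- exact: le_trans H_le_lower lower_le_L.
Qed.
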